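(* Let $m\ge 2$ and $1<q\le m$ be integers, let $X_1,\ldots,X_n$ be i.i.d. random variables with law $P$ taking values in a measurable space $\mathcal{X}$, and let $h:\mathcal{X}^m\to\mathbb{R}$ be a measurable symmetric kernel that is $P$-degenerate of order $q-1$. Write $m_h=\mathbb{E}\,h(X_1,\ldots,X_m)$ and assume that $\sigma^2=\mathrm{Var}(h(X_1,\ldots,X_m))<\infty$. Let $\delta\in(0,\tfrac12)$ be such that $\lceil \log(1/\delta)\rceil\le \frac{n}{64m}$. Let $\mathcal{B}$ be a regular partition of $\{1,\ldots,n\}$ with $|\mathcal{B}|=32m\lceil\log(1/\delta)\rceil$ blocks. Then, with probability at least $1-2\delta$, $$\left|\overline{U}_{\mathcal{B}}(h)-m_h\right|\le K_m\,\sigma\left(\frac{\lceil\log(1/\delta)\rceil}{n}\right)^{q/2},$$ where $K_m=2^{\frac72 m+1}m^{\frac m2}$.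
   Context: Here $\lceil\cdot\rceil$ is the ceiling function and $\log$ is the natural logarithm. Symmetric kernel: $h:\mathcal{X}^m\to\mathbb{R}$ is symmetric if $h(x_1,\ldots,x_m)=h(x_{s_1},\ldots,x_{s_m})$ for all $x_1,\ldots,x_m\in\mathcal{X}$ and all permutations $s$ of $\{1,\ldots,m\}$. $P$-degenerate: a symmetric kernel $h$ is $P$-degenerate of order $q-1$, $1<q\le m$, if for all $x_1,\ldots,x_{q-1}\in\mathcal{X}$, $$\int h(x_1,\ldots,x_m)\,dP^{m-q+1}(x_q,\ldots,x_m)=\int h(x_1,\ldots,x_m)\,dP^m(x_1,\ldots,x_m),$$ and the function $(x_1,\ldots,x_q)\mapsto\int h(x_1,\ldots,x_m)\,dP^{m-q}(x_{q+1},\ldots,x_m)$ is not constant (for $q=m$ this function is $h$ itself). Regular partition: a partition $\mathcal{B}=(B_1,\ldots,B_V)$ of $\{1,\ldots,n\}$, $V=|\mathcal{B}|\le n$, is regular if $\left||B_K|-\frac nV\right|\le 1$ for all $K=1,\ldots,V$. Block statistics: for blocks $B_{i_1},\ldots,B_{i_m}$ of $\mathcal{B}$, $$U_{B_{i_1},\ldots,B_{i_m}}(h)=\frac{1}{|B_{i_1}|\cdots|B_{i_m}|}\sum_{k_1\in B_{i_1},\ldots,k_m\in B_{i_m}}h(X_{k_1},\ldots,X_{k_m}).$$ Median: for $(a_1,\ldots,a_N)\in\mathbb{R}^N$, $\mathrm{Med}(a_1,\ldots,a_N)$ is any number $b$ with $|\{i\le N: a_i\le b\}|\ge N/2$ and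 $|\{i\le N:a_i\ge b\}|\ge N/2$. Robust estimator: $$\overline{U}_{\mathcal{B}}(h)=\mathrm{Med}\{U_{B_{i_1},\ldots,B_{i_m}}(h): 1\le i_1<\cdots<i_m\le V\}.$$ *)

(* Defs.v *)
From HB Require Import structures.
From mathcomp Require Import all_boot all_order all_fingroup all_algebra.
From mathcomp Require Import all_classical all_reals all_analysis.
Import Order.TTheory GRing.Theory Num.Theory.
Import numFieldNormedType.Exports.

Set Implicit Arguments.
Unset Strict Implicit.
Unset Printing Implicit Defensive.

Local Open Scope classical_set_scope.
Local Open Scope ring_scope.

Section tuple_power.
Context {d} {T : measurableType d}.

Definition tcons_pair (n : nat) (x : T * n.-tuple T) : n.+1.-tuple T :=
  [tuple of x.1 :: x.2].

Lemma measurable_tcons_pair (n : nat) : measurable_fun setT (@tcons_pair n).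
Proof. exact: measurable_cons. Qed.

HB.instance Definition _ (n : nat) :=
  isMeasurableFun.Build _ _ _ _ (@tcons_pair n) (@measurable_tcons_pair n).

(* The product measure P^n on T^n (with its product sigma-algebra): P^0 is the
   unit mass on the empty tuple and P^(n+1) is the image of P \x P^n under
   (x, v) |-> x :: v. *)
Fixpoint power_prob {R : realType} (P : probability T R) (n : nat) :
    probability (n.-tuple T) R :=
  match n return probability (n.-tuple T) R with
  | 0 => dirac ([tuple] : 0.-tuple T)
  | n'.+1 => distribution (P \x power_prob P n')%E (@tcons_pair n')
  end.

End tuple_power.

Section kernels.
Context {d} {T : measurableType d} {R : realType} {m : nat}.

Definition symmetric_kernel (h : m.-tuple T -> R) :=
  forall (s : 'S_m) (x : m.-tuple T), h [tuple tnth x (s i) | i < m] = h x.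

(* u |-> \int h(u_1, ..., u_r, v) dP^(m - r)(v).  The integral is the
   extended-real one, so an equation with a finite right-hand side forces the
   section of a measurable h to be integrable. *)
Definition partial_integral (P : probability T R) (h : m.-tuple T -> R)
    (r : nat) (hr : (r <= m)%N) (u : r.-tuple T) : \bar R :=
  (\int[power_prob P (m - r)]_v (h (tcast (subnKC hr) [tuple of u ++ v]))%:E)%E.

(* Degeneracy of order q - 1. *)
Definition degenerate_kernel (P : probability T R) (q : nat) (hqm : (q <= m)%N)
    (h : m.-tuple T -> R) :=
  (forall u : q.-1.-tuple T,
     partial_integral P h (leq_trans (leq_pred q) hqm) u =
     (\int[power_prob P m]_x (h x)%:E)%E) /\
  ~ (exists c : \bar R, forall u : q.-tuple T, partial_integral P h hqm u = c).

End kernels.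

Section random_variables.
Context {d d'} {Omega : measurableType d} {T : measurableType d'} {R : realType}.

Definition mutually_independent (Pr : probability Omega R) (I : finType)
    (X : I -> {mfun Omega >-> T}) :=
  forall (J : {set I}) (A : I -> set T),
    (forall i, i \in J -> measurable (A i)) ->
    (Pr (\bigcap_(i in [set` J]) X i @^-1` A i) =
     \prod_(i in J) Pr (X i @^-1` A i))%E.

(* "E holds with probability at least p" for an event E that need not be
   measurable, such as one involving an arbitrary choice of median: E contains
   a measurable event of probability at least p. *)
Definition holds_with_prob (Pr : probability Omega R) (p : R) (E : set Omega) :=
  exists A : set Omega, [/\ measurable A, A `<=` E & (p%:E <= Pr A)%E].

End random_variables.

(* The blocks B_1, ..., B_V are the values of B; injectivity together with
   [finset.partition] (whose blocks are nonempty) says that they are V distinct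
   nonempty sets partitioning {0, ..., n-1}. *)
Definition regular_partition (R : realType) (n V : nat)
    (B : 'I_V -> {set 'I_n}) :=
  [/\ injective B,
      finset.partition (B @: 'I_V) [set: 'I_n]%SET &
      forall K, `| #|B K|%:R - n%:R / V%:R : R | <= 1].

Definition block_stat (R : realType) (T : Type) (n V m : nat)
    (B : 'I_V -> {set 'I_n}) (h : m.-tuple T -> R) (x : 'I_n -> T)
    (i : m.-tuple 'I_V) : R :=
  (\prod_(j < m) #|B (tnth i j)|%:R)^-1 *
  \sum_(k : m.-tuple 'I_n | [forall j, tnth k j \in B (tnth i j)])
     h [tuple x (tnth k j) | j < m].

Definition increasing_index (m V : nat) : pred (m.-tuple 'I_V) :=
  fun i => sorted ltn (map val i).

(* b is a median of the family (a i), i ranging over A. *)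
Definition is_median (R : realType) (I : finType) (A : pred I) (a : I -> R)
    (b : R) :=
  #|A|%:R / 2 <= #|[pred i in A | a i <= b]|%:R :> R /\
  #|A|%:R / 2 <= #|[pred i in A | b <= a i]|%:R :> R.

Definition ceil_log (R : realType) (delta : R) : int := Num.ceil (ln (1 / delta)).

(* Types the tuple (X_1, ..., X_m) extracted from the sample X_1, ..., X_n. *)
Lemma sample_size_ge (R : realType) (m n : nat) (delta : R) :
  0 < delta < 1 / 2 -> (ceil_log delta)%:~R <= n%:R / (64 * m%:R) :> R ->
  (m <= n)%N.
Proof.
move=> /andP[d0 d12]; case: (posnP m) => [->//|m0].
have L1 : 1 <= (ceil_log delta)%:~R :> R.
  have dV : 1 < 1 / delta.
    by rewrite ltr_pdivlMr// mul1r (lt_trans d12)// ltr_pdivrMr// mul1r ltr1n.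
  have L0 : 0 < ceil_log delta by rewrite /ceil_log ceil_gt0 ln_gt0.
  by rewrite ler1z -gtz0_ge1.
move=> /(le_trans L1); rewrite ler_pdivlMr ?mulr_gt0 ?ltr0n// mul1r -natrM ler_nat.
by apply: leq_trans; rewrite leq_pmull.
Qed.

(* Main.v *)
(** Let [L] be the ceiling of [log (1 / delta)], so that there are [V = 32 m L]
    blocks, and call a block statistic bad if it deviates from [m_h] by more
    than the stated bound.  By degeneracy, two summands of a block statistic
    that share fewer than [q] observations are uncorrelated; as blocks have at
    least [n / (2 V)] elements, the variance of a block statistic is at most
    [2 ^ m (2 V / n) ^ q sigma ^ 2], and Chebyshev's inequality shows that it is
    bad with probability at most [1 / 4].  If the median deviates, at least half
    of the block statistics are bad.  As for Hoeffding's bound for U-statistics,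
    the proportion of bad ones is an average, over the permutations of the
    blocks, of proportions among [32 L] block statistics that use disjoint
    groups of [m] blocks and are therefore independent.  The Chernoff bound with
    parameter [ln 2] then gives a probability of at most
    [(7 / 8) ^ (32 L) <= delta]. *)

From HB Require Import structures.
Require Import Defs.
From mathcomp Require Import all_boot all_order all_fingroup all_algebra.
From mathcomp Require Import all_classical all_reals all_analysis.
From mathcomp Require Import measurable_realfun ring lra.
Import Order.TTheory GRing.Theory Num.Theory.
Import numFieldNormedType.Exports.

Set Implicit Arguments.
Unset Strict Implicit.
Unset Printing Implicit Defensive.

Local Open Scope classical_set_scope.
Local Open Scope ring_scope.

(** * Independence: from stable classes of events to generated sigma-algebras *)

Section independence.
Local Open Scope ereal_scope.
Context {d} {Omega : measurableType d} {R : realType}.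
Variable Pr : probability Omega R.

Definition indep_events (A B : set Omega) := Pr (A `&` B) = Pr A * Pr B.

Lemma indep_eventsC A B : indep_events A B -> indep_events B A.
Proof. by rewrite /indep_events setIC muleC. Qed.

(** The events independent of [B] form a Dynkin system, so the pi-lambda theorem applies. *)
Lemma indep_g_sigma_algebra (G : set (set Omega)) (B : set Omega) :
  measurable B -> G `<=` measurable -> setI_closed G ->
  (forall A, G A -> indep_events A B) ->
  forall A, <<s G >> A -> indep_events A B.
Proof.
move=> mB Gm GI GB A sA.
pose H := [set E | measurable E /\ indep_events E B].
suff : H A by case.
apply: (@lambda_system_subset _ G GI setT H _ _ _ A sA) => //; last first.
  by move=> E GE; split; [exact: Gm|exact: GB].
apply/dynkin_lambda_system; split.
- by split=> //; rewrite /indep_events setTI probability_setT mul1e.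
- move=> E [mE EB]; split; first exact: measurableC.
  rewrite /indep_events setIC -setDE measureD//; last by rewrite ltey_eq fin_num_measure.
  rewrite [X in Pr B - X](_ : _ = Pr E * Pr B) ?probability_setC//; last by rewrite setIC.
  by rewrite muleBl ?fin_num_measure// ?mul1e// fin_num_adde_defr.
- move=> F tF HF; split; first by apply: bigcupT_measurable => k; case: (HF k).
  rewrite /indep_events setI_bigcupl.
  rewrite !measure_bigcup//; last 3 first.
  + by move=> k _; case: (HF k).
  + by move=> k _; apply: measurableI => //; case: (HF k).
  + exact: trivIset_setIr.
  rewrite muleC -(fineK (fin_num_measure Pr _ mB)) -nneseriesZl//.
  apply: eq_eseriesr => k _; rewrite fineK ?fin_num_measure// muleC.
  by case: (HF k).
Qed.

End independence.

Section cylinders.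
Context {d d'} {Omega : measurableType d} {T : measurableType d'} {R : realType}.
Variables (Pr : probability Omega R) (I : finType) (X : I -> {mfun Omega >-> T}).

(** A pi-system generating the sigma-algebra of the observations with index in [J]. Membership in
    [<<s cylinders X J >>] records on which observations an event depends. *)
Definition cylinders (J : {set I}) : set (set Omega) :=
  [set E | exists2 A : I -> set T, forall i, measurable (A i) &
    E = \bigcap_(i in [set` J]) X i @^-1` A i].

Lemma cylinders_measurable J : cylinders J `<=` measurable.
Proof.
move=> _ [A mA ->]; apply: fin_bigcap_measurable => [|i _].
  exact: finite_finset.
by rewrite -[X in measurable X]setTI; exact: measurable_funP.
Qed.

Lemma cylinders_setI J : setI_closed (cylinders J).
Proof.
move=> _ _ [A mA ->] [B mB ->]; exists (fun i => A i `&` B i).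
  by move=> i; exact: measurableI.
by rewrite -bigcapI.
Qed.

Lemma cylindersS (J J' : {set I}) : J \subset J' -> cylinders J `<=` cylinders J'.
Proof.
move=> JJ' _ [A mA ->]; exists (fun i => if i \in J then A i else setT).
  by move=> i; case: ifP.
apply/seteqP; split => w /= Aw i /= iJ; last first.
  by have := Aw i (fintype.subsetP JJ' _ iJ); rewrite /= iJ.
by case: ifPn => // {}iJ; exact: Aw.
Qed.

Lemma cylindersX (J : {set I}) (A : set T) i : i \in J -> measurable A ->
  cylinders J (X i @^-1` A).
Proof.
move=> iJ mA; exists (fun j => if j == i then A else setT).
  by move=> j; case: ifP.
apply/seteqP; split => w /= Aw; last by have := Aw i iJ; rewrite /= eqxx.
by move=> j /= jJ; case: eqP => // ->.
Qed.

Lemma sub_cylinders_measurable J : <<s cylinders J >> `<=` measurable.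
Proof.
apply: smallest_sub; [exact: sigma_algebra_measurable|exact: cylinders_measurable].
Qed.

Hypothesis X_indep : mutually_independent Pr X.

(** The pi-lambda argument is applied twice, once to each event, which leaves the case of two
    cylinders. *)
Lemma indep_cylinders (J J' : {set I}) (A B : set Omega) : [disjoint J & J']%B ->
  <<s cylinders J >> A -> <<s cylinders J' >> B -> indep_events Pr A B.
Proof.
move=> JJ' sA sB; have mB := sub_cylinders_measurable sB.
apply: (@indep_g_sigma_algebra _ _ _ _ (cylinders J)) sA => //.
- exact: cylinders_measurable.
- exact: cylinders_setI.
move=> {}A GA; have mA := cylinders_measurable GA; apply: indep_eventsC.
apply: (@indep_g_sigma_algebra _ _ _ _ (cylinders J')) sB => //.
- exact: cylinders_measurable.
- exact: cylinders_setI.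
move=> {mB}B [b mb ->]; case: GA => a ma ->; apply: indep_eventsC.
rewrite /indep_events !X_indep//.
(* The two families of sides are glued into one over [J :|: J'], so that the product formula applies
   to a single intersection; disjointness makes the gluing consistent. *)
pose c i := if i \in J then a i else b i.
transitivity (Pr (\bigcap_(i in [set` J :|: J']) X i @^-1` c i)).
  congr (Pr _); apply/seteqP; split => [w [aw bw] i /=|w cw].
    rewrite inE /c; case: ifPn => [iJ _|_ /= iJ']; first exact: aw.
    exact: bw.
  split => i /= iJ.
    by have := cw i; rewrite /c /= inE iJ /=; exact.
  have := cw i; rewrite /c /= inE iJ orbT ifN; first exact.
  by rewrite (disjointFl JJ').
rewrite X_indep; last by move=> i _; rewrite /c; case: ifP.
rewrite (eq_bigl [predU J & J']); last by move=> i; rewrite !inE.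
rewrite bigU//=; congr (_ * _)%E; apply: eq_bigr => i iJ; rewrite /c ?iJ//.
by rewrite (disjointFl JJ').
Qed.

End cylinders.

Section family.
Context {d d'} {Omega : measurableType d} {T : measurableType d'} {R : realType}.
Variables (Pr : probability Omega R) (I : finType) (X : I -> {mfun Omega >-> T}).

Lemma sub_cylindersS (J J' : {set I}) : J \subset J' ->
  <<s cylinders X J >> `<=` <<s cylinders X J' >>.
Proof.
by move=> JJ'; apply: smallest_sub => [|A /(cylindersS JJ')];
  [exact: smallest_sigma_algebra|exact: sub_sigma_algebra].
Qed.

Lemma sub_cylinders_bigcap (K : finType) (S : {set K}) (J : {set I})
    (E : K -> set Omega) :
  (forall k, k \in S -> <<s cylinders X J >> (E k)) ->
  <<s cylinders X J >> (\big[setI/setT]_(k in S) E k).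
Proof.
move=> sE; apply: (big_ind (fun A => <<s cylinders X J >> A)) => //.
- have := @measurableT _ (g_sigma_algebraType (cylinders X J)); exact.
- by move=> A B; exact: (@measurableI _ (g_sigma_algebraType (cylinders X J))).
Qed.

Hypothesis X_indep : mutually_independent Pr X.

(** Induction on the size of [S]: one event is split off, and the intersection of the others depends
    only on the union of their index sets, which is disjoint from that of the chosen event. *)
Lemma indep_cylinders_family (K : finType) (J : K -> {set I})
    (E : K -> set Omega) (S : {set K}) :
  {in S &, forall k l, k != l -> [disjoint J k & J l]%B} ->
  (forall k, k \in S -> <<s cylinders X (J k) >> (E k)) ->
  (Pr (\big[setI/setT]_(k in S) E k) = \prod_(k in S) Pr (E k))%E.
Proof.
have [n] := ubnP #|S|; elim: n S => // n IH S leSn JJ sE.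
have [->|[k kS]] := set_0Vmem S; first by rewrite !big_set0 probability_setT.
rewrite !(big_setD1 k kS)/=.
have subS l : l \in S :\ k -> l \in S by rewrite !inE => /andP[].
rewrite -IH; first last.
- by move=> l /subS; exact: sE.
- by move=> l1 l2 /subS l1S /subS; exact: JJ.
- by move: leSn; rewrite (cardsD1 k) kS.
apply: (@indep_cylinders _ _ _ _ _ _ _ _ X_indep (J k) (\bigcup_(l in S :\ k) J l)%SET).
- apply/bigcup_disjointP => l; rewrite !inE => /andP[lk lS].
  by rewrite disjoint_sym JJ// eq_sym.
- exact: sE.
- apply: sub_cylinders_bigcap => l lS.
  by apply: (sub_cylindersS _ (sE _ (subS _ lS))); apply: finset.bigcup_sup.
Qed.

End family.

(** * Laws of samples with distinct indices *)

Section sample.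
Context {d d'} {Omega : measurableType d} {T : measurableType d'} {R : realType}.
Variables (Pr : probability Omega R) (I : finType) (X : I -> {mfun Omega >-> T}).

Definition sample (r : nat) (k : r.-tuple I) (w : Omega) : r.-tuple T :=
  [tuple X (tnth k j) w | j < r].

Lemma measurable_sample r (k : r.-tuple I) : measurable_fun setT (sample k).
Proof.
apply/measurable_fun_tnthP => j.
rewrite (_ : _ \o _ = X (tnth k j)); first exact: measurable_funP.
by apply/funext => w /=; rewrite tnth_mktuple.
Qed.

HB.instance Definition _ r (k : r.-tuple I) :=
  isMeasurableFun.Build _ _ _ _ (sample k) (measurable_sample k).

(** Measurability for the sub-sigma-algebra, and not just the ambient one, is what makes events
    about a sub-sample subject to [indep_cylinders]. *)
Lemma measurable_sample_cylinders (J : {set I}) r (k : r.-tuple I) :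
  (forall j, tnth k j \in J) ->
  measurable_fun [set: g_sigma_algebraType (cylinders X J)] (sample k).
Proof.
move=> kJ; apply/measurable_fun_tnthP => j.
rewrite (_ : _ \o _ = X (tnth k j)).
  move=> _ A mA; rewrite setTI; apply: sub_sigma_algebra.
  exact: cylindersX.
by apply/funext => w /=; rewrite tnth_mktuple.
Qed.

Lemma sample_cylinders (J : {set I}) r (k : r.-tuple I) A :
  (forall j, tnth k j \in J) -> measurable A ->
  <<s cylinders X J >> (sample k @^-1` A).
Proof.
move=> kJ mA; have := @measurable_sample_cylinders J r k kJ measurableT A mA.
by rewrite setTI.
Qed.

End sample.

Section joint_law.
Local Open Scope ereal_scope.
Context {d d1 d2} {Omega : measurableType d} {T1 : measurableType d1}
  {T2 : measurableType d2} {R : realType}.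
Variables (Pr : probability Omega R) (m1 : probability T1 R) (m2 : probability T2 R).
Variables (Y1 : {mfun Omega >-> T1}) (Y2 : {mfun Omega >-> T2}).
Hypothesis Y12 : forall A B, measurable A -> measurable B ->
  Pr (Y1 @^-1` A `&` Y2 @^-1` B) = m1 A * m2 B.

Let pair12 w := (Y1 w, Y2 w).

Lemma measurable_pair12 : measurable_fun setT pair12.
Proof. by apply: measurable_fun_pair. Qed.

HB.instance Definition _ := isMeasurableFun.Build _ _ _ _ pair12 measurable_pair12.

(** By [Y12] the two measures agree on rectangles, and this determines a product measure. *)
Lemma joint_lawE A : measurable A -> distribution Pr pair12 A = (m1 \x m2) A.
Proof.
by move=> mA; apply/esym; apply: product_measure_unique.
Qed.

(** Fubini's theorem on the product space, after integrability has been carried over from [Pr] to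
    the joint law. *)
Lemma integral_joint_law (f : T1 * T2 -> \bar R) :
  measurable_fun [set: T1 * T2] f ->
  Pr.-integrable setT (fun w => f (Y1 w, Y2 w)) ->
  \int[Pr]_w f (Y1 w, Y2 w) = \int[m1]_x \int[m2]_y f (x, y).
Proof.
move=> mf fi.
have fi' : (m1 \x m2).-integrable setT f.
  apply/integrableP; split => //.
  rewrite -(@eq_measure_integral _ _ _ _ _ (distribution Pr pair12)); last first.
    by move=> A mA _; exact: joint_lawE.
  rewrite ge0_integral_distribution//; last exact: measurableT_comp.
  by case/integrableP : fi.
rewrite integral12_prod_meas1//.
rewrite -(@eq_measure_integral _ _ _ _ _ (distribution Pr pair12)); last first.
  by move=> A mA _; exact: joint_lawE.
by rewrite integral_distribution.
Qed.

End joint_law.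

Section sample_law.
Local Open Scope ereal_scope.
Context {d d'} {Omega : measurableType d} {T : measurableType d'} {R : realType}.
Variables (Pr : probability Omega R) (P : probability T R) (I : finType).
Variable X : I -> {mfun Omega >-> T}.
Hypothesis X_indep : mutually_independent Pr X.
Hypothesis X_law : forall i A, measurable A -> distribution Pr (X i) A = P A.

(** Induction along the recursive definition of [power_prob]: as indices do not repeat, the first
    observation is independent of the remaining ones. *)
Lemma sample_law r (k : r.-tuple I) A : uniq k -> measurable A ->
  Pr (sample X k @^-1` A) = power_prob P r A.
Proof.
elim: r k A => [|r IH] k A uk mA.
  rewrite /= /dirac/= indicE.
  have [A0|A0] := boolP ([tuple] \in A).
    rewrite (_ : _ @^-1` _ = setT) ?probability_setT//.
    by apply/seteqP; split => w //= _; rewrite tuple0; exact/set_mem.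
  rewrite (_ : _ @^-1` _ = set0) ?measure0//.
  apply/seteqP; split => w //=; rewrite tuple0 => A0'.
  by move/negP : A0; apply; exact/mem_set.
case/tupleP: k => a k in uk *; move: uk => /= /andP[ak uk].
have consE w : sample X [tuple of a :: k] w = tcons_pair (X a w, sample X k w).
  apply: (@eq_from_tnth r.+1 T) => j; rewrite tnth_mktuple /tcons_pair.
  case: (unliftP ord0 j) => [j'|] ->; last by rewrite !tnth0.
  by rewrite !tnthS tnth_mktuple.
have -> : sample X [tuple of a :: k] @^-1` A =
    (fun w => (X a w, sample X k w)) @^-1` (@tcons_pair _ T r @^-1` A).
  by apply/seteqP; split => w /=; rewrite consE.
have mA' : measurable (@tcons_pair _ T r @^-1` A).
  by rewrite -[X in measurable X]setTI; exact: measurable_tcons_pair.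
transitivity ((P \x power_prob P r) (@tcons_pair _ T r @^-1` A)); last by [].
rewrite -(joint_lawE (Pr := Pr) (Y1 := X a) (Y2 := sample X k))//.
move=> B C mB mC; rewrite -(IH k)// -(X_law a)//.
apply: (@indep_cylinders _ _ _ _ _ _ _ _ X_indep [set a]%SET [set i in k]%SET).
- by rewrite disjoints1 inE.
- by apply: sub_sigma_algebra; apply: cylindersX => //; rewrite inE.
- by apply: sample_cylinders => // j; rewrite inE mem_tnth.
Qed.

Lemma integral_sample r (k : r.-tuple I) (f : r.-tuple T -> \bar R) : uniq k ->
  measurable_fun setT f -> Pr.-integrable setT (f \o sample X k) ->
  \int[Pr]_w f (sample X k w) = \int[power_prob P r]_x f x.
Proof.
move=> uk mf fi; rewrite -[LHS](integral_distribution (X := sample X k))//.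
by apply: eq_measure_integral => A mA _; exact: (sample_law uk mA).
Qed.

Lemma ge0_integral_sample r (k : r.-tuple I) (f : r.-tuple T -> \bar R) :
  uniq k -> measurable_fun setT f -> (forall x, 0 <= f x) ->
  \int[Pr]_w f (sample X k w) = \int[power_prob P r]_x f x.
Proof.
move=> uk mf f0; rewrite -[LHS](ge0_integral_distribution (sample X k) mf f0).
by apply: eq_measure_integral => A mA _; exact: (sample_law uk mA).
Qed.

End sample_law.

(** An extended-real difference is finite only if both terms are, so the positive and negative parts
    both have finite integrals. This turns the degeneracy identities into integrability of
    sections. *)
Lemma integrable_of_fin_num d (T : measurableType d) (R : realType)
    (mu : {measure set T -> \bar R}) (f : T -> \bar R) :
  measurable_fun setT f -> (\int[mu]_x f x)%E \is a fin_num ->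
  mu.-integrable setT f.
Proof.
move=> mf; rewrite integralE fin_numB => /andP[fp fn].
rewrite [f]funeposneg; apply: integrableB => //.
- apply/integrableP; split; first exact: measurable_funepos.
  by under eq_integral do rewrite gee0_abs//; rewrite ltey_eq fp.
- apply/integrableP; split; first exact: measurable_funeneg.
  by under eq_integral do rewrite gee0_abs//; rewrite ltey_eq fn.
Qed.

Lemma measurable_cat_tcast d (T : measurableType d) (r m : nat) (hr : (r <= m)%N) :
  measurable_fun [set: r.-tuple T * (m - r).-tuple T]
    (fun x => tcast (subnKC hr) [tuple of x.1 ++ x.2]).
Proof.
apply/measurable_fun_tnthP => i.
pose j := cast_ord (esym (subnKC hr)) i.
have E x : (tnth (T := T) ^~ i \o
    (fun x : r.-tuple T * (m - r).-tuple T =>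
       tcast (subnKC hr) [tuple of x.1 ++ x.2])) x =
    tnth [tuple of x.1 ++ x.2] j.
  by rewrite /= tcastE.
rewrite (funext E); case: (split_ordP j) => l ->.
- rewrite (_ : (fun _ => _) = (fun x => tnth x l) \o fst).
    by apply: measurableT_comp => //; exact: measurable_tnth.
  by apply/funext => x; rewrite /= tnth_lshift.
- rewrite (_ : (fun _ => _) = (fun x => tnth x l) \o snd).
    by apply: measurableT_comp => //; exact: measurable_tnth.
  by apply/funext => x; rewrite /= tnth_rshift.
Qed.

Section sample_kernel.
Context {d d'} {Omega : measurableType d} {T : measurableType d'} {R : realType}.
Variables (I : finType) (X : I -> {mfun Omega >-> T}).

Lemma val_sample r (k : r.-tuple I) w :
  sample X k w = [seq X i w | i <- k] :> seq T.
Proof.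
rewrite -[RHS]/(val (map_tuple (fun i => X i w) k)); congr val.
by apply: eq_from_tnth => j; rewrite tnth_mktuple tnth_map.
Qed.

Lemma sample_cat r m (hr : (r <= m)%N) (u : r.-tuple I) (v : (m - r).-tuple I) w :
  sample X (tcast (subnKC hr) [tuple of u ++ v]) w =
  tcast (subnKC hr) [tuple of sample X u w ++ sample X v w].
Proof.
by apply: val_inj; rewrite /= val_sample !val_tcast /= !val_sample map_cat.
Qed.

Lemma symmetric_kernel_sample m (h : m.-tuple T -> R) (k k' : m.-tuple I) w :
  symmetric_kernel h -> perm_eq k k' -> h (sample X k w) = h (sample X k' w).
Proof.
move=> h_sym /tuple_permP[p kE]; rewrite -[RHS](h_sym p); congr h.
apply: eq_from_tnth => i; rewrite !tnth_mktuple.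
have -> // : tnth k i = tnth k' (p i).
have -> : k = [tuple tnth k' (p i) | i < m] by exact: val_inj.
by rewrite tnth_mktuple.
Qed.

End sample_kernel.

(** * Covariances of kernel values that share observations *)

Section covariance.
Context {d d'} {Omega : measurableType d} {T : measurableType d'} {R : realType}.
Variables (Pr : probability Omega R) (P : probability T R) (I : finType).
Variable X : I -> {mfun Omega >-> T}.
Hypothesis X_indep : mutually_independent Pr X.
Hypothesis X_law : forall i A, measurable A -> distribution Pr (X i) A = P A.
Variables (m : nat) (h : {mfun m.-tuple T >-> R}) (c s2 : R).
Hypothesis h_sym : symmetric_kernel h.
Hypothesis h_var : (\int[power_prob P m]_x ((h x - c) ^+ 2)%:E)%E = s2%:E.

Definition centered (k : m.-tuple I) (w : Omega) : R := h (sample X k w) - c.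

Lemma measurable_centered k : measurable_fun setT (centered k).
Proof.
by apply: measurable_funB => //; exact: measurableT_comp.
Qed.

Lemma measurable_sqr_centered :
  measurable_fun [set: m.-tuple T] (fun x => ((h x - c) ^+ 2)%:E).
Proof.
by apply/measurable_EFinP; apply: measurable_funX; exact: measurable_funB.
Qed.

Lemma integral_sqr_centered (k : m.-tuple I) : uniq k ->
  (\int[Pr]_w (centered k w ^+ 2)%:E = s2%:E)%E.
Proof.
move=> uk; rewrite -h_var -(ge0_integral_sample X_indep X_law uk)//.
- exact: measurable_sqr_centered.
- by move=> x; rewrite lee_fin sqr_ge0.
Qed.

Lemma integrable_sqr_centered (k : m.-tuple I) : uniq k ->
  Pr.-integrable setT (fun w => (centered k w ^+ 2)%:E).
Proof.
move=> uk; apply: integrable_of_fin_num; last by rewrite integral_sqr_centered.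
apply/measurable_EFinP; apply: measurable_funX; exact: measurable_centered.
Qed.

(** The product is dominated by the sum of the two squares. *)
Lemma integrable_centeredM (k k' : m.-tuple I) : uniq k -> uniq k' ->
  Pr.-integrable setT (fun w => (centered k w * centered k' w)%:E).
Proof.
move=> uk uk'.
apply: (le_integrable _ _ _ (integrableD _ (integrable_sqr_centered uk)
  (integrable_sqr_centered uk'))) => //.
- apply/measurable_EFinP; apply: measurable_funM; exact: measurable_centered.
- move=> w _; rewrite /= lee_fin [leRHS]ger0_norm ?addr_ge0 ?sqr_ge0// normrM.
  rewrite -(real_normK (num_real (centered k w))).
  rewrite -(real_normK (num_real (centered k' w))).
  move: `|centered k w| `|centered k' w| (normr_ge0 (centered k w)) => a b a0.
  by nra.
Qed.

(** From [a b <= (a^2 + b^2) / 2], both squares having integral [s2]. *)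
Lemma covariance_centered_le (k k' : m.-tuple I) : uniq k -> uniq k' ->
  (\int[Pr]_w (centered k w * centered k' w)%:E <= s2%:E)%E.
Proof.
move=> uk uk'.
apply: (@le_trans _ _ (\int[Pr]_w ((1 / 2)%:E *
    ((centered k w ^+ 2)%:E + (centered k' w ^+ 2)%:E)))%E).
  apply: le_integral => //.
  - exact: integrable_centeredM.
  - by apply: integrableZl => //; apply: integrableD => //; exact: integrable_sqr_centered.
  - move=> w _; rewrite -EFinD -EFinM lee_fin.
    by have := sqr_ge0 (centered k w - centered k' w); nra.
rewrite integralZl//; last by apply: integrableD => //; exact: integrable_sqr_centered.
rewrite integralD//; [|exact: integrable_sqr_centered|exact: integrable_sqr_centered].
rewrite !integral_sqr_centered// -EFinD -EFinM lee_fin.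
by lra.
Qed.

Variables (r : nat) (hr : (r <= m)%N).
Hypothesis h_degen : forall u : r.-tuple T, partial_integral P h hr u = c%:E.

(* The indices of [k] that also occur in [k'] are moved to the first [r]
   positions; the remaining [m - r] observations are then independent of all the
   others and are integrated out by degeneracy. *)
Lemma covariance_centered_eq0 (k k' : m.-tuple I) : uniq k -> uniq k' ->
  (count (mem k') k <= r)%N ->
  (\int[Pr]_w (centered k w * centered k' w)%:E = 0)%E.
Proof.
move=> uk uk' kk'.
pose s := [seq x <- k | x \in k'] ++ [seq x <- k | x \notin k'].
have perm_s : perm_eq k s by rewrite perm_sym; exact/permPl/perm_filterC.
have us : uniq s by rewrite -(perm_uniq perm_s).
have ss : size s = m by rewrite -(perm_size perm_s) size_tuple.
have su : size (take r s) == r by rewrite size_takel// ss.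
have sv : size (drop r s) == (m - r)%N by rewrite size_drop ss.
pose u := Tuple su; pose v := Tuple sv.
have kE w : h (sample X k w) =
    h (tcast (subnKC hr) [tuple of sample X u w ++ sample X v w]).
  rewrite -sample_cat; apply: symmetric_kernel_sample => //.
  by rewrite val_tcast /= cat_take_drop.
have uv : uniq v by exact: drop_uniq.
have vk' i : i \in v -> i \notin k'.
  rewrite -[i \in v]/(i \in drop r s) drop_cat ltnNge size_filter kk' /=.
  by move/mem_drop; rewrite mem_filter => /andP[].
have vu i : i \in v -> i \notin u.
  move=> iv; apply/negP => iu.
  by move: us; rewrite -(cat_take_drop r s) cat_uniq => /and3P[_ /hasPn/(_ _ iv)/negP].
pose J : {set I} := [set i in k' ++ u]%SET.
pose Y1 w := (sample X k' w, sample X u w).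
have mY1 : measurable_fun setT Y1 by exact: measurable_fun_pair.
have mY1J : measurable_fun [set: g_sigma_algebraType (cylinders X J)] Y1.
  apply: measurable_fun_pair; apply: measurable_sample_cylinders => j.
    by rewrite inE mem_cat mem_tnth.
  by rewrite inE mem_cat mem_tnth orbT.
pose Y1m : {mfun Omega >-> _} := HB.pack Y1 (isMeasurableFun.Build _ _ _ _ Y1 mY1).
have Y12 A B : measurable A -> measurable B ->
    (Pr (Y1m @^-1` A `&` sample X v @^-1` B) =
     distribution Pr Y1m A * power_prob P (m - r) B)%E.
  move=> mA mB; rewrite -(sample_law X_indep X_law uv mB).
  apply: (@indep_cylinders _ _ _ _ _ _ _ _ X_indep J [set i in v]%SET).
  - apply/pred0P => i; rewrite /= !inE mem_cat; apply/negP => /andP[] /orP[] ik iv.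
      by move: (vk' _ iv); rewrite ik.
    by move: (vu _ iv); rewrite ik.
  - by have := mY1J measurableT A mA; rewrite setTI.
  - by apply: sample_cylinders => // j; rewrite inE mem_tnth.
pose g (x : r.-tuple T) (y : (m - r).-tuple T) := h (tcast (subnKC hr) [tuple of x ++ y]).
pose f (x : (m.-tuple T * r.-tuple T) * (m - r).-tuple T) :=
  ((h x.1.1 - c) * (g x.1.2 x.2 - c))%:E.
have mg : measurable_fun [set: r.-tuple T * (m - r).-tuple T] (fun x => g x.1 x.2).
  by apply: measurableT_comp => //; exact: measurable_cat_tcast.
have mf : measurable_fun [set: (m.-tuple T * r.-tuple T) * (m - r).-tuple T] f.
  apply/measurable_EFinP; apply: measurable_funM; apply: measurable_funB => //.
    by apply: measurableT_comp => //; exact: measurableT_comp.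
  rewrite (_ : (fun _ => _) = (fun x => g x.1 x.2) \o
    (fun x : (m.-tuple T * r.-tuple T) * (m - r).-tuple T => (x.1.2, x.2)))//.
  by apply: (measurableT_comp mg); apply: measurable_fun_pair => //; exact: measurableT_comp.
have fE w : (centered k w * centered k' w)%:E = f (Y1m w, sample X v w).
  by rewrite /f /centered kE mulrC.
under eq_integral do rewrite fE.
rewrite (integral_joint_law Y12)//; last first.
  by rewrite -(funext fE); exact: integrable_centeredM.
rewrite (eq_integral (cst 0%E)) ?integral0// => x _.
have gi : (power_prob P (m - r)).-integrable setT (fun y => (g x.2 y)%:E).
  apply: integrable_of_fin_num.
    have mgx : measurable_fun setT ((fun x => g x.1 x.2) \o
        (fun y : (m - r).-tuple T => (x.2, y))).
      by apply: (measurableT_comp mg); exact: measurable_fun_pair.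
    exact/measurable_EFinP.
  by rewrite [X in X \is a fin_num](h_degen x.2).
have ci : (power_prob P (m - r)).-integrable setT (EFin \o cst c).
  by apply: finite_measure_integrable_cst.
under eq_integral do rewrite /f /= EFinM.
rewrite integralZl//; last first.
  by under eq_fun do rewrite EFinB; exact: integrableB.
under eq_integral do rewrite EFinB.
rewrite integralB// [X in (X - _)%E](h_degen x.2) /= integral_cst//.
rewrite [X in (c%:E - c%:E * X)%E](_ : _ = 1%E); last exact: probability_setT.
by rewrite mule1 subee// mule0.
Qed.

End covariance.

(** * Counting overlapping transversals of disjoint blocks *)

Lemma sum_tuple_prod (R : comNzRingType) (I : finType) (m : nat)
    (A : 'I_m -> {set I}) (F : 'I_m -> I -> R) :
  \sum_(k : m.-tuple I | [forall j, tnth k j \in A j]) \prod_j F j (tnth k j) =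
  \prod_j \sum_(x in A j) F j x.
Proof.
rewrite bigA_distr_big_dep.
rewrite (reindex (fun f : {ffun 'I_m -> I} => [tuple f j | j < m])); last first.
  exists (fun k => [ffun j => tnth k j]) => [f _|k _].
    by apply/ffunP => j; rewrite ffunE tnth_mktuple.
  by apply: eq_from_tnth => j; rewrite tnth_mktuple ffunE.
apply: eq_big => [f|f _].
  by apply: eq_forallb => j; rewrite tnth_mktuple.
by apply: eq_bigr => j _; rewrite tnth_mktuple.
Qed.

Section overlap.
Variables (R : realFieldType) (I : finType) (m : nat) (A : 'I_m -> {set I}) (y : R).
Hypothesis A_disj : forall j j', j != j' -> [disjoint A j & A j']%B.
Hypotheses (y_gt0 : 0 < y) (y_le1 : y <= 1) (A_ge : forall j, 1 <= y * #|A j|%:R).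

Lemma uniq_transversal (k : m.-tuple I) : [forall j, tnth k j \in A j] -> uniq k.
Proof.
move=> /forallP kA; apply/tuple_uniqP => j j' e; apply/eqP/negPn/negP => jj'.
by have /pred0P/(_ (tnth k j)) := A_disj jj'; rewrite /= kA e kA.
Qed.

(** Since the blocks are disjoint, a common value must sit at the same coordinate of both tuples. *)
Lemma count_transversal (k k' : m.-tuple I) :
  [forall j, tnth k j \in A j] -> [forall j, tnth k' j \in A j] ->
  count (mem k') k = #|[pred j | tnth k j == tnth k' j]|.
Proof.
move=> /forallP kA /forallP k'A.
rewrite -{1}(map_tnth_enum k) -sum1_count big_map big_enum_cond /= sum1_card.
apply: eq_card => j.
rewrite -[LHS]/(tnth k j \in k') inE.
apply/idP/eqP => [/tnthP[j' e]|->]; last exact: mem_tnth.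
have [jj'|jj'] := eqVneq j' j; first by rewrite e jj'.
by have /pred0P/(_ (tnth k j)) := A_disj jj'; rewrite /= kA {1}e k'A.
Qed.

(* Since [y <= 1], the indicator of an overlap of size at least [q] is at most
   [y ^+ q] times a product of factors [y^-1] or [1] over the coordinates, and
   the sum of such a product factorises. *)
Lemma card_overlap_le (q : nat) (k : m.-tuple I) : [forall j, tnth k j \in A j] ->
  #|[pred k' : m.-tuple I | [forall j, tnth k' j \in A j] &
      (q <= count (mem k') k)%N]|%:R
    <= y ^+ q * 2 ^+ m * \prod_j #|A j|%:R :> R.
Proof.
move=> kA.
pose F j x : R := if tnth k j == x then y^-1 else 1.
have yV_ge1 : 1 <= y^-1 by rewrite invf_ge1.
apply: (@le_trans _ _ (y ^+ q *
    \sum_(k' : m.-tuple I | [forall j, tnth k' j \in A j]) \prod_j F j (tnth k' j))).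
  rewrite -sum1_card natr_sum big_mkcondr /= mulr_sumr.
  apply: ler_sum => k' k'A; case: ifPn => [|_]; last first.
    apply: mulr_ge0; first exact/exprn_ge0/ltW.
    by apply: prodr_ge0 => j _; rewrite /F; case: ifP; rewrite // invr_ge0 ltW.
  rewrite count_transversal// => qle.
  rewrite -big_mkcond /= prodr_const exprVn.
  rewrite ler_pdivlMr ?exprn_gt0// mul1r.
  by apply: ler_wiXn2l => //; exact: ltW.
rewrite sum_tuple_prod -mulrA ler_pM2l ?exprn_gt0//.
rewrite -[m in 2 ^+ m]card_ord -prodr_const -big_split /=.
apply: ler_prod => j _; apply/andP; split.
  by apply: sumr_ge0 => x _; rewrite /F; case: ifP; rewrite // invr_ge0 ltW.
have kj : tnth k j \in A j by exact/(forallP kA).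
rewrite (bigD1 (tnth k j))//= /F eqxx.
rewrite (eq_bigr (fun=> 1)); last by move=> x /andP[_ /negPf]; rewrite eq_sym => ->.
rewrite mulr_natl mulr2n lerD//.
  by rewrite -(ler_pM2l y_gt0) divff// gt_eqF.
rewrite sumr_const ler_nat; apply: subset_leq_card.
by apply/fintype.subsetP => x /andP[].
Qed.

End overlap.

(** * Chebyshev's inequality at level one quarter *)

Lemma measurable_norm_gt d (T : measurableType d) (R : realType) (f : T -> R)
    (t : R) : measurable_fun setT f -> measurable [set x | t < `|f x|].
Proof.
move=> mf; rewrite (_ : [set _ | _] = setT `&` [set x | (t%:E < `|(f x)%:E|)%E]).
  apply: measurable_lte => //.
  by apply: measurableT_comp => //; exact/measurable_EFinP.
by rewrite setTI; apply/seteqP; split => x /=; rewrite lte_fin.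
Qed.

(** For [t > 0] this is Markov's inequality for the square. The case [t = 0] serves kernels of zero
    variance: then [v <= 0], so [f] vanishes almost everywhere. *)
Lemma sqr_markov d (T : measurableType d) (R : realType) (Pr : probability T R)
    (f : T -> R) (v t : R) : measurable_fun setT f ->
  (\int[Pr]_x (f x ^+ 2)%:E <= v%:E)%E -> 0 <= t -> 4 * v <= t ^+ 2 ->
  (Pr [set x | (t < `|f x|)%R] <= (1 / 4)%:E)%E.
Proof.
move=> mf fv t0 vt.
have mf2 : measurable_fun setT (fun x => (f x ^+ 2)%:E).
  by apply/measurable_EFinP; exact: measurable_funX.
have mft := measurable_norm_gt t mf.
have abs2 : (\int[Pr]_x `|(f x ^+ 2)%:E| = \int[Pr]_x (f x ^+ 2)%:E)%E.
  by apply: eq_integral => x _; rewrite gee0_abs// lee_fin sqr_ge0.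
have [t_gt0|] := ltP 0 t; last first.
  move=> t_le0; have {t0 t_le0}t0 : t = 0 by apply/le_anti/andP.
  have v0 : v <= 0 by move: vt; rewrite t0 expr0n /=; lra.
  have /(ae_eq_integral_abs Pr measurableT mf2)[N [mN N0 fN]] : (
      \int[Pr]_x `|(f x ^+ 2)%:E| = 0)%E.
    rewrite abs2; apply/eqP; rewrite eq_le (le_trans fv) ?lee_fin//=.
    by apply: integral_ge0 => x _; rewrite lee_fin sqr_ge0.
  apply: (@le_trans _ _ (Pr N)); last by rewrite N0 lee_fin.
  apply: le_measure; rewrite ?inE// => x /=; rewrite t0 normr_gt0 => fx.
  apply: fN => /= /(_ Logic.I) [] /eqP; rewrite sqrf_eq0; exact/negP.
have := le_integral_abse Pr measurableT mf2 (exprn_gt0 2 t_gt0).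
rewrite abs2 => /le_trans/(_ fv) le_v.
have {}le_v : ((t ^+ 2)%:E * Pr [set x | (t < `|f x|)%R] <= v%:E)%E.
  apply: le_trans le_v; apply: lee_wpmul2l; first by rewrite lee_fin sqr_ge0.
  apply: le_measure; rewrite ?inE//.
    by apply: emeasurable_fun_c_infty => //; exact: measurableT_comp.
  move=> x /= tf; split => //; rewrite lee_fin ger0_norm ?sqr_ge0//.
  by rewrite -(real_normK (num_real (f x))) ler_pXn2r ?nnegrE// ltW.
move: le_v; rewrite -(fineK (fin_num_measure Pr _ mft)) -EFinM !lee_fin => le_v.
rewrite -(ler_pM2l (exprn_gt0 2 t_gt0)) (le_trans le_v)//; lra.
Qed.

(** * Variance of a block statistic *)

Section block_variance.
Context {d d'} {Omega : measurableType d} {T : measurableType d'} {R : realType}.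
Variables (Pr : probability Omega R) (P : probability T R) (n : nat).
Variable X : 'I_n -> {mfun Omega >-> T}.
Hypothesis X_indep : mutually_independent Pr X.
Hypothesis X_law : forall i A, measurable A -> distribution Pr (X i) A = P A.
Variables (m : nat) (h : {mfun m.-tuple T >-> R}) (c s2 : R).
Hypothesis h_sym : symmetric_kernel h.
Hypothesis h_var : (\int[power_prob P m]_x ((h x - c) ^+ 2)%:E)%E = s2%:E.
Variables (r : nat) (hr : (r <= m)%N).
Hypothesis h_degen : forall u : r.-tuple T, partial_integral P h hr u = c%:E.
Variables (V : nat) (B : 'I_V -> {set 'I_n}) (y : R).
Hypothesis B_disj : forall K L, K != L -> [disjoint B K & B L]%B.
Hypotheses (y_gt0 : 0 < y) (y_le1 : y <= 1) (B_ge : forall K, 1 <= y * #|B K|%:R).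

Let stat (i : m.-tuple 'I_V) w := block_stat B h (fun k => X k w) i.

Lemma block_gt0 K : 0 < #|B K|%:R :> R.
Proof. by rewrite -(pmulr_rgt0 _ y_gt0) (lt_le_trans ltr01). Qed.

Variable i : m.-tuple 'I_V.
Hypothesis i_uniq : uniq i.

Let A (j : 'I_m) := B (tnth i j).
Let b : R := \prod_j #|A j|%:R.

Let A_disj j j' : j != j' -> [disjoint A j & A j']%B.
Proof. by move=> jj'; apply: B_disj; rewrite (inj_eq (tuple_uniqP _ i_uniq)). Qed.

Let b_gt0 : 0 < b.
Proof. by apply: prodr_gt0 => j _; exact: block_gt0. Qed.

Let sum_transversal1 :
  \sum_(k : m.-tuple 'I_n | [forall j, tnth k j \in A j]) 1 = b.
Proof.
transitivity (\sum_(k : m.-tuple 'I_n | [forall j, tnth k j \in A j])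
    \prod_(j < m) (fun (_ : 'I_m) (_ : 'I_n) => 1 : R) j (tnth k j)).
  by apply: eq_bigr => k _; rewrite big1.
rewrite (sum_tuple_prod A (fun _ _ => 1)).
by apply: eq_bigr => j _; rewrite sumr_const.
Qed.

Let statB w : stat i w - c =
  b^-1 * \sum_(k : m.-tuple 'I_n | [forall j, tnth k j \in A j]) centered X h c k w.
Proof.
rewrite /stat /block_stat -/b /centered sumrB mulrBr; congr (_ - _).
rewrite [in RHS](eq_bigr (fun=> 1 * c)); last by move=> k _; rewrite mul1r.
by rewrite -mulr_suml sum_transversal1 mulrA mulVf ?mul1r// gt_eqF.
Qed.

Let adm (p : m.-tuple 'I_n * m.-tuple 'I_n) :=
  [forall j, tnth p.1 j \in A j] && [forall j, tnth p.2 j \in A j].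

(** Extension by zero makes every summand integrable, as the interchange of sum and integral
    demands: a tuple that is not a transversal may repeat an index. *)
Let cov p w : R := if adm p then centered X h c p.1 w * centered X h c p.2 w else 0.

Let sqr_statB w : (stat i w - c) ^+ 2 = b^-1 ^+ 2 * \sum_p cov p w.
Proof.
rewrite statB exprMn; congr (_ * _).
by rewrite expr2 big_distrlr /= pair_big /= big_mkcond.
Qed.

Let cov_integrable p : Pr.-integrable setT (fun w => (cov p w)%:E).
Proof.
rewrite /cov; have [/andP[p1 p2]|_] := boolP (adm p); last exact: integrable0.
by apply: (integrable_centeredM X_indep X_law h_var);
  exact: (uniq_transversal A_disj).
Qed.

Let s2_ge0 : 0 <= s2.
Proof.
by rewrite -lee_fin -h_var; apply: integral_ge0 => x _; rewrite lee_fin sqr_ge0.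
Qed.

Let cov_le p : (\int[Pr]_w (cov p w)%:E <=
  (if adm p && (r < count (mem p.2) p.1)%N then s2 else 0)%:E)%E.
Proof.
rewrite /cov; have [/andP[p1 p2]|_] /= := boolP (adm p); last by rewrite integral0.
have u1 := uniq_transversal A_disj p1; have u2 := uniq_transversal A_disj p2.
case: ltnP => [_|le]; first exact: (covariance_centered_le X_indep X_law h_var).
by rewrite (covariance_centered_eq0 X_indep X_law h_sym h_var h_degen).
Qed.

(** The square expands into covariances over the [b ^+ 2] pairs of transversals. Pairs with at most
    [r] common indices contribute nothing; the others make up a fraction of at most
    [y ^+ r.+1 * 2 ^+ m] and contribute at most [s2] each. *)
Lemma block_stat_variance :
  (\int[Pr]_w ((stat i w - c) ^+ 2)%:E <= (y ^+ r.+1 * 2 ^+ m * s2)%:E)%E.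
Proof.
under eq_integral do rewrite sqr_statB EFinM -sumEFin.
rewrite integralZl//; last exact: integrable_sum.
rewrite integral_sum//.
apply: (@le_trans _ _ ((b^-1 ^+ 2)%:E *
    (\sum_p if adm p && (r < count (mem p.2) p.1)%N then s2 else 0)%:E)%E).
  apply: lee_wpmul2l; first by rewrite lee_fin sqr_ge0.
  by rewrite -sumEFin; apply: lee_sum => p _; exact: cov_le.
rewrite -EFinM lee_fin exprVn ler_pdivrMl ?exprn_gt0//.
rewrite -big_mkcond /= (eq_bigl (fun p => [forall j, tnth p.1 j \in A j] &&
  ([forall j, tnth p.2 j \in A j] && (r < count (mem p.2) p.1)%N))); last first.
  by move=> p; rewrite /adm andbA.
rewrite -(pair_big_dep (fun k : m.-tuple 'I_n => [forall j, tnth k j \in A j])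
  (fun k k' : m.-tuple 'I_n => [forall j, tnth k' j \in A j] && (r < count (mem k') k)%N)
  (fun _ _ => s2)) /=.
apply: (@le_trans _ _ (\sum_(k : m.-tuple 'I_n | [forall j, tnth k j \in A j])
    1 * (y ^+ r.+1 * 2 ^+ m * b * s2))).
  apply: ler_sum => k kA; rewrite sumr_const mul1r -[leLHS]mulr_natl.
  apply: ler_wpM2r => //.
  exact: (card_overlap_le A_disj y_gt0 y_le1 (fun j => B_ge (tnth i j)) r.+1 kA).
by rewrite -mulr_suml sum_transversal1; rewrite le_eqVlt; apply/orP; left; apply/eqP; ring.
Qed.

(** The statistic depends only on the observations in its own blocks; hence statistics built on
    disjoint groups of blocks are independent. *)
Lemma measurable_block_stat_cylinders :
  measurable_fun [set: g_sigma_algebraType (cylinders X (\bigcup_j A j)%SET)] (stat i).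
Proof.
rewrite /stat /block_stat; apply: measurable_funM; first exact: measurable_cst.
rewrite [X in measurable_fun _ X](_ : _ = fun w => \sum_(k : m.-tuple 'I_n)
  if [forall j, tnth k j \in B (tnth i j)] then h (sample X k w) else 0); last first.
  by apply/funext => w; rewrite -big_mkcond.
apply: measurable_sum => k.
have [/forallP kA|_] := boolP [forall j, tnth k j \in B (tnth i j)]; last exact: measurable_cst.
apply: measurableT_comp => //; apply: measurable_sample_cylinders => j.
by apply/bigcupP; exists j.
Qed.

Lemma exceed_cylinders (t : R) : <<s cylinders X (\bigcup_j A j)%SET >>
  [set w | (t < `|stat i w - c|)%R].
Proof.
apply: (@measurable_norm_gt _ (g_sigma_algebraType (cylinders X (\bigcup_j A j)%SET))).
by apply: measurable_funB => //; exact: measurable_block_stat_cylinders.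
Qed.

Lemma prob_exceed_le (t : R) : 0 <= t -> 4 * (y ^+ r.+1 * 2 ^+ m * s2) <= t ^+ 2 ->
  (Pr [set w | (t < `|stat i w - c|)%R] <= (1 / 4)%:E)%E.
Proof.
move=> t0 ht; apply: (sqr_markov _ block_stat_variance) => //.
apply: measurable_funB => // _ Y mY.
apply: sub_cylinders_measurable; exact: measurable_block_stat_cylinders.
Qed.

End block_variance.

(** * Averaging over permutations of the blocks *)

Section averaging.
Variables (m V : nat).
Implicit Types (i : m.-tuple 'I_V) (s : {perm 'I_V}).

Lemma sort_val_ord (t : seq 'I_V) :
  map val (sort (fun a b : 'I_V => (a <= b)%N) t) = sort leq (map val t).
Proof. by rewrite sort_map. Qed.

(** The median ranges over increasing indices only, so the permuted index is sorted again; this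
    leaves its set of blocks unchanged. *)
Definition relabel i s : m.-tuple 'I_V :=
  sort_tuple (fun a b : 'I_V => (a <= b)%N) (map_tuple s i).

Lemma perm_relabel i s : perm_eq (relabel i s) (map s i).
Proof. by rewrite /= perm_sort. Qed.

Lemma increasing_uniq i : increasing_index i -> uniq i.
Proof.
by move=> /(sorted_uniq ltn_trans ltnn); rewrite map_inj_uniq//; exact: val_inj.
Qed.

Lemma increasing_relabel i s : uniq i -> increasing_index (relabel i s).
Proof.
move=> ui; rewrite /increasing_index /= sort_val_ord.
rewrite ltn_sorted_uniq_leq sort_uniq sort_sorted; last exact: leq_total.
by rewrite (map_inj_uniq val_inj) (map_inj_uniq perm_inj) ui.
Qed.

(** An increasing tuple is determined by its entries, so fibres of [relabel] can be described
    without sorting. *)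
Lemma relabel_eq i s i0 : increasing_index i0 ->
  (relabel i s == i0) = perm_eq (map s i) i0.
Proof.
move=> inc0; apply/eqP/idP => [<-|p]; first by rewrite perm_sym perm_relabel.
apply: val_inj; apply: (inj_map val_inj).
apply: (irr_sorted_eq ltn_trans ltnn) => //.
- apply: increasing_relabel; rewrite -(map_inj_uniq (@perm_inj _ s)).
  by rewrite (perm_uniq p) increasing_uniq.
- apply/perm_mem/perm_map; exact: perm_trans (perm_relabel i s) p.
Qed.

(** Each tuple is completed to an enumeration of ['I_V] by appending the missing elements; the
    permutation matches the two enumerations position by position. *)
Lemma uniq_tuple_perm i i' : uniq i -> uniq i' ->
  exists s : {perm 'I_V}, map s i = i'.
Proof.
move=> ui ui'.
pose ext (t : m.-tuple 'I_V) := t ++ [seq x <- enum 'I_V | x \notin t].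
have ext_mem t x : x \in ext t.
  by rewrite mem_cat mem_filter mem_enum andbT orbN.
have ext_uniq (t : m.-tuple 'I_V) : uniq t -> uniq (ext t).
  move=> ut; rewrite cat_uniq ut filter_uniq ?enum_uniq// andbT /=.
  by apply/hasPn => x; rewrite mem_filter => /andP[].
have ext_size (t : m.-tuple 'I_V) : uniq t -> size (ext t) = V.
  move=> /ext_uniq/card_uniqP <-; rewrite -[RHS]card_ord.
  by apply: eq_card => x; rewrite ext_mem.
pose f x := nth x (ext i') (index x (ext i)).
have f_inj : injective f.
  have lt_idx x : (index x (ext i) < size (ext i'))%N.
    by rewrite (ext_size _ ui') -[X in (_ < X)%N](ext_size _ ui) index_mem.
  move=> x x'; rewrite /f (set_nth_default x x' (lt_idx x')) => /eqP.
  rewrite nth_uniq ?ext_uniq// => /eqP/(congr1 (nth x (ext i))).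
  by rewrite !nth_index.
exists (perm f_inj); rewrite -[RHS]/(val i') -[LHS]/(val (map_tuple (perm f_inj) i)).
congr val; apply: eq_from_tnth => j; rewrite tnth_map permE /f.
rewrite index_cat mem_tnth (tnth_nth (tnth i j)) index_uniq ?size_tuple//.
by rewrite nth_cat size_tuple ltn_ord -tnth_nth.
Qed.

(* All fibres of [relabel i] have the same cardinality: multiplication by a
   permutation carrying [j] to [j'] maps the fibre over [j] into the one over [j']. *)
Lemma sum_relabel (R : comNzRingType) (F : m.-tuple 'I_V -> R) i : uniq i ->
  (\sum_s F (relabel i s)) * #|@increasing_index m V|%:R =
  (V`!)%:R * \sum_(j in @increasing_index m V) F j.
Proof.
move=> ui.
pose N j := #|[pred s | relabel i s == j]|.
have sumF (G : m.-tuple 'I_V -> R) :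
    \sum_s G (relabel i s) = \sum_(j in @increasing_index m V) G j * (N j)%:R.
  rewrite (partition_big (relabel i) (mem (@increasing_index m V))) /=; last first.
    by move=> s _; exact: increasing_relabel.
  apply: eq_bigr => j _; rewrite (eq_bigr (fun=> G j)); last by move=> s /eqP ->.
  by rewrite sumr_const mulr_natr.
have N_le j j' : increasing_index j -> increasing_index j' -> (N j <= N j')%N.
  move=> inc inc'.
  have [t tE] := uniq_tuple_perm (increasing_uniq inc) (increasing_uniq inc').
  rewrite /N -(card_imset _ (mulIg t)); apply/subset_leq_card/fintype.subsetP => u.
  move=> /imsetP[s]; rewrite !inE !relabel_eq// => sj ->; rewrite -tE.
  rewrite (eq_map (permM s t)) map_comp; exact: perm_map.
pose j0 := relabel i 1%g.
have inc0 : increasing_index j0 by exact: increasing_relabel.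
have NE j : j \in @increasing_index m V -> N j = N j0.
  by move=> inc; apply/eqP; rewrite eqn_leq !N_le.
have fact : (V`!)%:R = (N j0 * #|@increasing_index m V|)%:R :> R.
  transitivity (\sum_(s : {perm 'I_V}) (1 : R)).
    by rewrite sumr_const -card_Sn; congr (_ *+ _).
  rewrite (sumF (fun=> 1)) (eq_bigr (fun=> (N j0)%:R)).
    by rewrite sumr_const natrM mulr_natr.
  by move=> j jinc; rewrite mul1r NE.
rewrite sumF fact (eq_bigr (fun j => F j * (N j0)%:R)).
  by rewrite -mulr_suml natrM; ring.
by move=> j jinc; rewrite NE.
Qed.

End averaging.

(** * The Chernoff bound for independent events *)

Section chernoff.
Context {d} {Omega : measurableType d} {R : realType}.
Variable Pr : probability Omega R.

(** The exponential weight with parameter [ln 2]: it equals 2 on [E] and 1/2 off [E]. Written as an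
    affine function of the indicator, it lets products expand into indicators of intersections. *)
Definition vote (E : set Omega) (w : Omega) : R := \1_E w * (3 / 2) + 1 / 2.

Lemma voteE E w : vote E w = expR (ln 2 * (2 * \1_E w - 1)).
Proof.
rewrite /vote indicE; case: (w \in E) => /=.
  by rewrite (_ : _ * (2 * 1 - 1) = ln 2); [rewrite lnK ?posrE//; lra|lra].
rewrite (_ : _ * (2 * 0 - 1) = - ln 2); last by lra.
by rewrite expRN lnK ?posrE//; lra.
Qed.

Variables (N : nat) (E : 'I_N -> set Omega).
Hypothesis mE : forall g, measurable (E g).

Lemma prod_vote w : \prod_g vote (E g) w =
  \sum_(S : {set 'I_N}) ((\prod_(g < N) if g \in S then 3 / 2 else 1 / 2) *
     \1_(\big[setI/setT]_(g in S) E g) w).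
Proof.
rewrite bigA_distr; apply: eq_bigr => S _.
have -> : \1_(\big[setI/setT]_(g in S) E g) w =
    \prod_(g in S) \1_(E g) w :> R.
  apply: (big_ind2 (fun A x => \1_A w = x :> R)) => //.
    by rewrite indicT.
  by move=> A x A' x' <- <-; rewrite indicI.
rewrite (big_mkcond (fun g => g \in S)) -big_split /=; apply: eq_bigr => g _.
by case: ifP => _; rewrite ?mulr1 1?mulrC.
Qed.

Lemma integrable_prod_vote :
  Pr.-integrable setT (fun w => (\prod_g vote (E g) w)%:E).
Proof.
under eq_fun do rewrite prod_vote -sumEFin.
apply: integrable_sum => // S _.
under eq_fun do rewrite EFinM.
apply: integrableZl => //; apply: integrable_indic.
by apply: bigsetI_measurable => g _.
Qed.

Hypothesis E_indep : forall S : {set 'I_N},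
  (Pr (\big[setI/setT]_(g in S) E g) = \prod_(g in S) Pr (E g))%E.
Hypothesis E_le : forall g, (Pr (E g) <= (1 / 4)%:E)%E.

Lemma integral_prod_vote_le :
  (\int[Pr]_w (\prod_g vote (E g) w)%:E <= ((7 / 8) ^+ N)%:E)%E.
Proof.
pose p g := fine (Pr (E g)).
have pE g : Pr (E g) = (p g)%:E by rewrite /p fineK// fin_num_measure.
have mES (S : {set 'I_N}) : measurable (\big[setI/setT]_(g in S) E g).
  by apply: bigsetI_measurable => g _.
(* After expansion over subsets, [E_indep] factors each probability and the sum folds back into a
   product of expectations. Each factor is at most [1/4 * 3/2 + 1/2 = 7/8]. *)
rewrite (_ : (\int[Pr]_w _)%E = (\prod_g (p g * (3 / 2) + 1 / 2))%:E).
  rewrite lee_fin -[N in leRHS]card_ord -prodr_const; apply: ler_prod => g _.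
  have p0 : 0 <= p g by rewrite fine_ge0.
  have p1 : p g <= 1 / 4 by rewrite -lee_fin -pE.
  by apply/andP; split; lra.
under eq_integral do rewrite prod_vote -sumEFin.
rewrite integral_sum//; last first.
  move=> S; under eq_fun do rewrite EFinM.
  by apply: integrableZl => //; exact: integrable_indic.
rewrite bigA_distr -sumEFin; apply: eq_bigr => S _.
under eq_integral do rewrite EFinM.
rewrite integralZl//; last exact: integrable_indic.
rewrite integral_indic// setIT [X in (_ * X)%E]E_indep (eq_bigr (fun g => (p g)%:E)) //.
rewrite prodEFin -EFinM; congr EFin.
rewrite (big_mkcond (fun g => g \in S)) -big_split /=; apply: eq_bigr => g _.
by case: ifP => _; rewrite ?mulr1 1?mulrC.
Qed.

End chernoff.

(** * Probability that at least half of the block statistics are bad *)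

Section majority.
Context {d} {Omega : measurableType d} {R : realType}.
Variables (Pr : probability Omega R) (m V N : nat).
Variables (bad : m.-tuple 'I_V -> set Omega) (iota : 'I_N -> m.-tuple 'I_V).
Hypothesis iota_uniq : forall g, uniq (iota g).
Hypothesis bad_measurable : forall i, measurable (bad i).
Hypothesis bad_le : forall i, increasing_index i -> (Pr (bad i) <= (1 / 4)%:E)%E.
Hypothesis bad_indep : forall (s : {perm 'I_V}) (S : {set 'I_N}),
  (Pr (\big[setI/setT]_(g in S) bad (relabel (iota g) s)) =
   \prod_(g in S) Pr (bad (relabel (iota g) s)))%E.

(** A measurable event that will contain every deviation of the estimator, whichever medians are
    chosen. *)
Definition majority_bad : set Omega := [set w |
  #|@increasing_index m V|%:R / 2 <= \sum_(i in @increasing_index m V) \1_(bad i) w :> R].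

Lemma measurable_majority_bad : measurable majority_bad.
Proof.
rewrite -[majority_bad]setTI; apply: measurable_fun_le => //.
rewrite [X in measurable_fun _ X](_ : _ = fun w => \sum_(i : m.-tuple 'I_V)
  if increasing_index i then \1_(bad i) w else 0 : R); last first.
  by apply/funext => w; rewrite -big_mkcond.
apply: measurable_sum => i; case: (increasing_index i); last exact: measurable_cst.
exact: measurable_indic.
Qed.

(* The product of votes is [2] to the power (bad - good), and [expR x >= 1 + x]
   replaces Jensen's inequality since bad - good has nonnegative average. *)
Lemma majority_bad_le_avg w : w \in majority_bad ->
  1 <= (V`!%:R)^-1 * \sum_(s : {perm 'I_V}) \prod_g vote (bad (relabel (iota g) s)) w :> R.
Proof.
rewrite inE /majority_bad /= => maj.
rewrite ler_pdivlMl ?ltr0n ?fact_gt0// mulr1.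
pose x (s : {perm 'I_V}) : R := \sum_g (2 * \1_(bad (relabel (iota g) s)) w - 1).
have x_ge0 : 0 <= \sum_s x s.
  rewrite exchange_big /=; apply: sumr_ge0 => g _.
  pose F i : R := 2 * \1_(bad i) w - 1.
  have inc0 : (0 < #|@increasing_index m V|)%N.
    by apply/card_gt0P; exists (relabel (iota g) 1%g); exact: increasing_relabel.
  have {}inc0 : 0 < #|@increasing_index m V|%:R :> R by rewrite ltr0n.
  rewrite -(pmulr_lge0 _ inc0) (sum_relabel F (iota_uniq g)) mulr_ge0//.
  by rewrite /F sumrB -mulr_sumr sumr_const; move: maj; lra.
apply: (@le_trans _ _ (\sum_(s : {perm 'I_V}) (1 + ln 2 * x s))).
  rewrite big_split /= -mulr_sumr sumr_const.
  rewrite [X in _ <= X + _](_ : _ = V`!%:R); last by rewrite -card_Sn; congr (_ *+ _).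
  by rewrite lerDl mulr_ge0// ln_ge0// ler1n.
apply: ler_sum => s _; under eq_bigr do rewrite voteE.
by rewrite -expR_sum -mulr_sumr expR_ge1Dx.
Qed.

(** The indicator of the event is at most the average over permutations of the products of votes.
    Linearity of the integral copes with the dependence between permutations, and the Chernoff bound
    is applied to each one separately. *)
Lemma prob_majority_bad_le : (Pr majority_bad <= ((7 / 8) ^+ N)%:E)%E.
Proof.
have int s : Pr.-integrable setT
    (fun w => (\prod_g vote (R := R) (bad (relabel (iota g) s)) w)%:E).
  exact: (integrable_prod_vote Pr (fun g => bad_measurable (relabel (iota g) s))).
have int_sum : Pr.-integrable setT (fun w => \sum_(s : {perm 'I_V})
    (\prod_g vote (bad (relabel (iota g) s)) w)%:E)%E.
  exact: integrable_sum.
have avgE w : ((V`!%:R)^-1 * \sum_(s : {perm 'I_V})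
      \prod_g vote (bad (relabel (iota g) s)) w)%:E =
    ((V`!%:R)^-1%:E * \sum_(s : {perm 'I_V})
      (\prod_g vote (R := R) (bad (relabel (iota g) s)) w)%:E)%E.
  by rewrite EFinM sumEFin.
rewrite -[majority_bad]setIT -integral_indic//; last exact: measurable_majority_bad.
apply: (@le_trans _ _ (\int[Pr]_w ((V`!%:R)^-1%:E * \sum_(s : {perm 'I_V})
    (\prod_g vote (R := R) (bad (relabel (iota g) s)) w)%:E))%E).
  apply: le_integral => //.
  - by apply: integrable_indic; exact: measurable_majority_bad.
  - exact: integrableZl.
  - move=> w _; rewrite -avgE lee_fin indicE.
    have [/majority_bad_le_avg//|_] := boolP (w \in majority_bad).
    apply: mulr_ge0; first by rewrite invr_ge0.
    by apply: sumr_ge0 => s _; apply: prodr_ge0 => g _; rewrite voteE expR_ge0.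
rewrite integralZl// integral_sum//.
apply: (@le_trans _ _ ((V`!%:R)^-1%:E *
    \sum_(s : {perm 'I_V}) ((7 / 8) ^+ N)%:E)%E).
  apply: lee_wpmul2l; first by rewrite lee_fin invr_ge0.
  apply: lee_sum => s _; apply: integral_prod_vote_le => //.
  by move=> g; apply/bad_le/increasing_relabel.
rewrite sumEFin -EFinM lee_fin sumr_const -[X in _ * X]mulr_natl.
rewrite (_ : #|_| = V`!); last by rewrite -card_Sn.
by rewrite mulrA mulVf ?mul1r// pnatr_eq0 -lt0n fact_gt0.
Qed.

End majority.

(** If the median lies below [c], all values below the median are at least as far from [c], and they
    make up at least half of the family; the other case is symmetric. *)
Lemma median_majority (R : realType) (I : finType) (A : pred I) (a : I -> R)
    (b c t : R) : is_median A a b -> t < `|b - c| ->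
  #|A|%:R / 2 <= \sum_(i in A) (t < `|a i - c|)%R%:R :> R.
Proof.
move=> [med_le med_ge] tb.
have sumE (Q : pred I) : #|[pred i in A | Q i]|%:R = \sum_(i in A) (Q i)%:R :> R.
  by rewrite -sum1_card natr_sum big_mkcondr; apply: eq_bigr => i _; case: (Q i).
have [bc|cb] := leP b c.
  apply: (le_trans med_le); rewrite sumE; apply: ler_sum => i _; rewrite ler_nat.
  case: (leP (a i) b) => // aib; rewrite (lt_le_trans tb)//.
  by rewrite !ler0_norm; lra.
apply: (le_trans med_ge); rewrite sumE; apply: ler_sum => i _; rewrite ler_nat.
case: (leP b (a i)) => // aib; rewrite (lt_le_trans tb)//.
by rewrite !ger0_norm; lra.
Qed.

(** * Mean and variance as integrals against the product law *)

Section moments.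
Context {d d'} {Omega : measurableType d} {T : measurableType d'} {R : realType}.
Variables (Pr : probability Omega R) (P : probability T R) (I : finType).
Variable X : I -> {mfun Omega >-> T}.
Hypothesis X_indep : mutually_independent Pr X.
Hypothesis X_law : forall i A, measurable A -> distribution Pr (X i) A = P A.
Variables (m : nat) (h : {mfun m.-tuple T >-> R}) (k : m.-tuple I).
Hypothesis k_uniq : uniq k.
Let Y w := h (sample X k w).
Hypothesis Y_var : ('V_Pr[Y] < +oo)%E.
Let c := fine 'E_Pr[Y].

Let Y_varE : 'V_Pr[Y] = (\int[Pr]_w ((Y w - c) ^+ 2)%:E)%E.
Proof.
rewrite /c /variance covariance.unlock expectation.unlock.
by apply: eq_integral => w _.
Qed.

Let Y_var_fin : 'V_Pr[Y] \is a fin_num.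
Proof.
rewrite ge0_fin_numE// Y_varE; apply: integral_ge0 => w _.
by rewrite lee_fin sqr_ge0.
Qed.

Lemma sample_variance :
  (\int[power_prob P m]_x ((h x - c) ^+ 2)%:E)%E = (fine 'V_Pr[Y])%:E.
Proof.
rewrite fineK// Y_varE -(ge0_integral_sample X_indep X_law k_uniq)//.
- exact: measurable_sqr_centered.
- by move=> x; rewrite lee_fin sqr_ge0.
Qed.

Lemma sample_mean : (\int[power_prob P m]_x (h x)%:E)%E = c%:E.
Proof.
have mY : measurable_fun setT Y by exact: measurableT_comp.
(* So far [c] is only the [fine] part of an expectation that could be infinite. Finiteness of the
   integral of [(Y - c)^2] yields integrability through [|Y| <= |c| + 1 + (Y - c)^2]. *)
have iY : Pr.-integrable setT (fun w => (Y w)%:E).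
  have i2 : Pr.-integrable setT (fun w => ((Y w - c) ^+ 2)%:E).
    apply: integrable_of_fin_num; last by rewrite -Y_varE.
    by apply/measurable_EFinP; apply: measurable_funX; exact: measurable_funB.
  have ic : Pr.-integrable setT (EFin \o cst (`|c| + 1)).
    exact: finite_measure_integrable_cst.
  apply: (le_integrable _ _ _ (integrableD _ ic i2)) => //.
    exact/measurable_EFinP.
  move=> w _; rewrite /= lee_fin [leRHS]ger0_norm; last first.
    by rewrite !addr_ge0// sqr_ge0.
  rewrite -[in leLHS](subrK c (Y w)) (le_trans (ler_normD _ _))//.
  rewrite -(real_normK (num_real (Y w - c))).
  by move: `|Y w - c| `|c| => u v; nra.
rewrite /c unlock fineK; last exact: integrable_fin_num.
rewrite -(integral_sample X_indep X_law k_uniq)//.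
exact/measurable_EFinP.
Qed.

End moments.

(** * Numerical bounds, block sizes and groups of blocks *)

Lemma powR_sqr (R : realType) (a : R) (e : R) (n : nat) : 0 <= a ->
  e * 2 = n%:R -> (a `^ e) ^+ 2 = a ^+ n.
Proof.
by move=> a0 en; rewrite -powR_mulrn ?powR_ge0// -powRrM en powR_mulrn.
Qed.

(** As [7/8 <= exp (-1/8)], the left side is at most [exp (-4 L)], hence at most [exp (-L)]. *)
Lemma eighths_le_delta (R : realType) (delta : R) (L : nat) : 0 < delta ->
  ln (1 / delta) <= L%:R -> (7 / 8) ^+ (32 * L) <= delta.
Proof.
move=> d0 dL.
apply: (@le_trans _ _ (expR (- (1 / 8)) ^+ (32 * L))).
  apply: lerXn2r; rewrite ?nnegrE ?expR_ge0 ?divr_ge0//.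
  by apply: le_trans (expR_ge1Dx _); lra.
rewrite -expRM_natl; apply: (@le_trans _ _ (expR (- ln (1 / delta)))).
  rewrite ler_expR natrM; have L0 : 0 <= L%:R :> R by [].
  by move: (ln _) dL => l; lra.
by rewrite div1r lnV ?posrE// opprK lnK ?posrE.
Qed.

Section regular_partition.
Variables (R : realType) (n V : nat) (B : 'I_V -> {set 'I_n}).
Hypothesis hB : regular_partition R B.

Lemma regular_partition_disjoint K L : K != L -> [disjoint B K & B L]%B.
Proof.
case: hB => B_inj /and3P[_ /finset.trivIsetP tB _] _ KL.
by apply: tB; rewrite ?imset_f// (inj_eq B_inj).
Qed.

(** Since [n / V >= 2], a block of size at least [n / V - 1] has at least [n / (2 V)] elements. *)
Lemma regular_partition_ge K : (0 < V)%N -> (2 * V <= n)%N ->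
  1 <= 2 * V%:R / n%:R * #|B K|%:R :> R.
Proof.
move=> V0 Vn; case: hB => _ _ /(_ K).
have V0R : 0 < V%:R :> R by rewrite ltr0n.
have VnR : 2 * V%:R <= n%:R :> R by rewrite -natrM ler_nat.
have n0R : 0 < n%:R :> R by rewrite (lt_le_trans _ VnR)// mulr_gt0.
rewrite ler_norml => /andP[+ _]; rewrite lerBrDr => bK.
have nV : 2 <= n%:R / V%:R :> R by rewrite ler_pdivlMr.
have half : n%:R / V%:R / 2 <= #|B K|%:R :> R by move: bK nV; lra.
apply: (@le_trans _ _ (2 * V%:R / n%:R * (n%:R / V%:R / 2))).
  by rewrite [leRHS](_ : _ = 1)//; field; rewrite !gt_eqF.
by rewrite ler_pM2l// divr_gt0// mulr_gt0.
Qed.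

End regular_partition.

Section groups.
Variables (m N V : nat).
Hypothesis VE : V = (N * m)%N.

Lemma group_subproof (g : 'I_N) (j : 'I_m) : (g * m + j < V)%N.
Proof.
rewrite VE; apply: (@leq_trans (g.+1 * m)); last by rewrite leq_mul2r ltn_ord orbT.
by rewrite mulSn addnC ltn_add2r.
Qed.

Definition group (g : 'I_N) : m.-tuple 'I_V := [tuple Ordinal (group_subproof g j) | j < m].

(** Quotient and remainder modulo [m] recover the group and the position in it. *)
Lemma group_inj g g' j j' : tnth (group g) j = tnth (group g') j' -> g = g' /\ j = j'.
Proof.
rewrite !tnth_mktuple => /(congr1 val) /= e.
have m0 : (0 < m)%N by apply: leq_trans (ltn_ord j).
split; apply: val_inj => /=.
  move: (congr1 (divn^~ m) e).
  by rewrite !divnMDl// !divn_small ?addn0.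
by move: (congr1 (modn^~ m) e); rewrite !modnMDl !modn_small.
Qed.

Lemma group_uniq g : uniq (group g).
Proof. by apply/tuple_uniqP => j j' /group_inj[]. Qed.

End groups.

(** This is where the constant arises. With [2 V / n = 64 m L / n], the left side is
    [4 * 2^m * (64 m)^q * s2 * (L / n)^q]; replacing [(64 m)^q] by [(64 m)^m] gives the coefficient
    [2^(7 m + 2) * m^m], the square of the constant. *)
Lemma deviation_bound (R : realType) (m q n L V : nat) (s2 : R) :
  (2 <= m)%N -> (q <= m)%N -> (0 < n)%N -> V = (32 * L * m)%N -> 0 <= s2 ->
  4 * ((2 * V%:R / n%:R) ^+ q * 2 ^+ m * s2) <=
  (2 `^ (7 / 2 * m%:R + 1) * m%:R `^ (m%:R / 2) * Num.sqrt s2 *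
    (L%:R / n%:R) `^ (q%:R / 2)) ^+ 2.
Proof.
move=> m2 qm n0 VE s0.
have -> : 2 * V%:R / n%:R = 64 * m%:R * (L%:R / n%:R) :> R.
  by rewrite VE !natrM; ring.
rewrite [_ ^+ q]exprMn [(64 * _) ^+ q]exprMn ![_ ^+ 2]exprMn.
rewrite sqr_sqrtr// (@powR_sqr _ _ _ (7 * m + 2))//; last first.
  by rewrite natrD natrM; lra.
rewrite (@powR_sqr _ _ _ m)//; last by lra.
rewrite (@powR_sqr _ _ _ q)//; last by lra.
set x := (L%:R / n%:R) ^+ q; have x0 : 0 <= x by rewrite exprn_ge0.
rewrite (_ : 2 ^+ (7 * m + 2) = 4 * (64 ^+ m * 2 ^+ m) :> R); last first.
  by rewrite exprD exprM mulrC -exprMn; congr (_ * _ ^+ _); lra.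
have le64 : 64 ^+ q <= 64 ^+ m :> R by rewrite ler_eXn2l ?ltr1n.
have lem : m%:R ^+ q <= m%:R ^+ m :> R.
  by rewrite ler_weXn2l// ler1n (leq_trans _ m2).
have := ler_pM (exprn_ge0 q (ler0n R 64)) (exprn_ge0 q (ler0n R m)) le64 lem.
move=> /(ler_wpM2r (mulr_ge0 x0 (mulr_ge0 (exprn_ge0 m (ler0n R 2)) s0))) H.
rewrite (_ : 4 * _ = 4 * (64 ^+ q * m%:R ^+ q * (x * (2 ^+ m * s2)))); last by ring.
rewrite (_ : _ * s2 * x = 4 * (64 ^+ m * m%:R ^+ m * (x * (2 ^+ m * s2)))); last by ring.
by rewrite ler_pM2l.
Qed.

(** * Assembly of the variance bound and the majority bound *)

Theorem theorem1 (R : realType) (dO dT : measure_display)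
    (Omega : measurableType dO) (T : measurableType dT)
    (Pr : probability Omega R) (P : probability T R)
    (m q n V : nat) (hm : (2 <= m)%N) (hq : (1 < q)%N) (hqm : (q <= m)%N)
    (X : 'I_n -> {mfun Omega >-> T})
    (X_indep : mutually_independent Pr X)
    (X_law : forall i (A : set T), measurable A -> distribution Pr (X i) A = P A)
    (h : {mfun (m.-tuple T) >-> R})
    (h_sym : symmetric_kernel h)
    (h_degen : degenerate_kernel P hqm h)
    (delta : R) (hdelta : 0 < delta < 1 / 2)
    (hL : (ceil_log delta)%:~R <= n%:R / (64 * m%:R) :> R)
    (hV : V%:Z = 32 * m%:Z * ceil_log delta)
    (B : 'I_V -> {set 'I_n}) (hB : regular_partition R B)
    (Ubar : Omega -> R)
    (hUbar : forall w, is_median (@increasing_index m V)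
       (block_stat B h (fun k => X k w)) (Ubar w)) :
  let Y := fun w : Omega =>
    h [tuple X (widen_ord (sample_size_ge hdelta hL) i) w | i < m] in
  ('V_Pr[Y] < +oo)%E ->
  let mh : R := fine 'E_Pr[Y] in
  let sigma : R := Num.sqrt (fine 'V_Pr[Y]) in
  let K : R := 2 `^ (7 / 2 * m%:R + 1) * m%:R `^ (m%:R / 2) in
  holds_with_prob Pr (1 - 2 * delta)
    [set w | `| Ubar w - mh |
             <= K * sigma * ((ceil_log delta)%:~R / n%:R) `^ (q%:R / 2)]%classic.
Proof.
move=> Y Y_var mh sigma K.
have delta0 : 0 < delta by case/andP: (hdelta).
have delta1 : delta < 1 by case/andP: (hdelta) => _; lra.
have m0 : (0 < m)%N by apply: leq_trans hm.
have lnd : 0 < ln (1 / delta).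
  by rewrite ln_gt0// ltr_pdivlMr// mul1r.
have ceil0 : 0 < ceil_log delta by rewrite /ceil_log ceil_gt0.
pose L := `|ceil_log delta|%N.
have LE : ceil_log delta = L%:Z by rewrite gez0_abs// ltW.
have L0 : (0 < L)%N by rewrite absz_gt0 gt_eqF.
have LR : (ceil_log delta)%:~R = L%:R :> R by rewrite LE.
have lnL : ln (1 / delta) <= L%:R by rewrite -LR; exact: ceil_ge.
have VE : V = (32 * L * m)%N.
  by apply/eqP; rewrite -eqz_nat hV LE -!PoszM mulnAC.
have Vn : (2 * V <= n)%N.
  move: (hL); rewrite LR ler_pdivlMr ?mulr_gt0 ?ltr0n// -!natrM ler_nat VE.
  by rewrite (_ : (2 * (32 * L * m) = L * (64 * m))%N)//; ring.
have V0 : (0 < V)%N by rewrite VE !muln_gt0 L0 m0.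
have n0 : (0 < n)%N by apply: leq_trans Vn; rewrite muln_gt0.
have q1 : q.-1.+1 = q by rewrite prednK// (leq_trans _ hq).
pose k0 : m.-tuple 'I_n := [tuple widen_ord (sample_size_ge hdelta hL) i | i < m].
have k0_uniq : uniq k0.
  apply/tuple_uniqP => i j; rewrite !tnth_mktuple => /(congr1 val) /= e.
  exact: val_inj.
have YE : Y = fun w => h (sample X k0 w).
  apply/funext => w; congr (h _); apply: eq_from_tnth => i.
  by rewrite !tnth_mktuple.
have Y_var' : ('V_Pr[(fun w => h (sample X k0 w))] < +oo)%E by rewrite -YE.
have h_var := sample_variance X_indep X_law k0_uniq Y_var'.
have h_mean := sample_mean X_indep X_law k0_uniq Y_var'.
rewrite -YE -/mh in h_var h_mean.
set s2 := fine 'V_Pr[Y] in h_var.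
have s2_ge0 : 0 <= s2.
  by rewrite -lee_fin -h_var; apply: integral_ge0 => x _; rewrite lee_fin sqr_ge0.
have h_deg u : partial_integral P h (leq_trans (leq_pred q) hqm) u = mh%:E.
  by rewrite (proj1 h_degen) h_mean.
(* An upper bound for the reciprocal of every block size; it is at most 1 because [2 V <= n]. *)
pose y : R := 2 * V%:R / n%:R.
have y_gt0 : 0 < y by rewrite divr_gt0 ?mulr_gt0 ?ltr0n.
have y_le1 : y <= 1 by rewrite ler_pdivrMr ?ltr0n// mul1r -natrM ler_nat.
have B_ge k : 1 <= y * #|B k|%:R by exact: regular_partition_ge.
have B_disj := regular_partition_disjoint hB.
rewrite LR; set t := _ * _ * _.
have t_ge0 : 0 <= t by rewrite !mulr_ge0 ?powR_ge0 ?sqrtr_ge0.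
(* The variance bound is used with [r = q.-1], so its exponent [r.+1] is [q]; the factor 4 is what
   Chebyshev's inequality needs for probability 1/4. *)
have ht : 4 * (y ^+ q.-1.+1 * 2 ^+ m * s2) <= t ^+ 2.
  by rewrite q1; exact: deviation_bound.
pose bad (i : m.-tuple 'I_V) : set Omega :=
  [set w | t < `|block_stat B h (fun k => X k w) i - mh|]%classic.
pose iota := group VE.
have badJ i : (<<s cylinders X (\bigcup_j B (tnth i j))%SET >> (bad i))%classic.
  exact: exceed_cylinders.
have bad_le i : increasing_index i -> (Pr (bad i) <= (1 / 4)%:E)%E.
  move=> /increasing_uniq ui.
  exact: (prob_exceed_le X_indep X_law h_sym h_var h_deg B_disj y_gt0 y_le1 B_ge ui).
(* A permutation keeps distinct groups disjoint and sorting does not alter their entries, so the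
   events involve disjoint sets of observations. *)
have bad_indep (s : {perm 'I_V}) (S : {set 'I_(32 * L)}) :
  (Pr (\big[setI/setT]_(g in S) bad (relabel (iota g) s)) =
   \prod_(g in S) Pr (bad (relabel (iota g) s)))%E.
  apply: (indep_cylinders_family X_indep
    (J := fun g => (\bigcup_j B (tnth (relabel (iota g) s) j))%SET)) => // g g' _ _ gg'.
  apply/bigcup_disjointP => j' _; rewrite disjoint_sym; apply/bigcup_disjointP => j _.
  apply: B_disj; apply: contraNneq gg' => e.
  have : tnth (relabel (iota g) s) j \in map s (iota g').
    by rewrite -e -(perm_mem (perm_relabel _ _)) mem_tnth.
  have : tnth (relabel (iota g) s) j \in map s (iota g).
    by rewrite -(perm_mem (perm_relabel _ _)) mem_tnth.
  move=> /mapP[x /tnthP[a ->] ->] /mapP[x' /tnthP[a' ->]] /perm_inj.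
  by move=> /group_inj[-> _].
have bad_meas i : measurable (bad i) by exact: sub_cylinders_measurable (badJ i).
have maj_le := prob_majority_bad_le (group_uniq VE) bad_meas bad_le bad_indep.
have mmaj := measurable_majority_bad (R := R) bad_meas.
(* The deviation event itself may fail to be measurable, hence this witness; its probability is in
   fact at least [1 - delta]. *)
exists (~` majority_bad (R := R) bad)%classic; split.
- exact: measurableC.
- move=> w /= nmaj; rewrite leNgt; apply/negP => tU; apply: nmaj.
  rewrite /majority_bad /=; have := median_majority (hUbar w) tU.
  by move=> /le_trans; apply; apply: ler_sum => i _; rewrite indicE mem_setE.
- rewrite probability_setC// EFinB leeB// (le_trans maj_le)// lee_fin.
  rewrite (le_trans (eighths_le_delta delta0 lnL))//; lra.
Qed.
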